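(* Let $n\geq 2$, let $\underline m=(m_1,\dots,m_l)$ be a composition of $n$, let $G=GL(n,\mathbb{R})$, let $P_{\underline m}$ be the associated standard parabolic subgroup, and let $B'$ be the standard Borel subgroup of $GL(n-1,\mathbb{R})\times GL(1,\mathbb{R})\subset G$. Then the closed $B'$-orbits on $G/P_{\underline m}$ coincide with the $B'$-fixed points. More precisely, they are the orbits of the normal forms satisfying (i) $k=0$, (ii) $i_{j_1,j_1'}<i_{j_2,j_2'}$ whenever $j_1<j_2$ (for all basis vectors $e_{i_{j_1,j_1'}}$ and $e_{i_{j_2,j_2'}}$ appearing in the blocks $A_{j_1}$ and $A_{j_2}$ respectively).
   Context: A composition of $n$ is a finite sequence of positive integers with sum $n$. $P_{\underline m}\subset GL(n,\mathbb{R})$ is the group of invertible block upper triangular matrices with diagonal blocks of sizes $m_1,\dots,m_l$. $B'$ is the group of upper triangular matrices in the block diagonal subgroup $GL(n-1,\mathbb{R})\times GL(1,\mathbb{R})$, acting on $G/P_{\underline m}$ by left multiplication; $G/P_{\underline m}$ carries the quotient topology. Let $(e_1,\dots,e_{n-1})$ be the canonical basis of $\mathbb{R}^{n-1}$. A normal form is (the coset in $G/P_{\underline m}$ of) an invertible matrix $A=\begin{bmatrix}A_1&\cdots&A_l\end{bmatrix}$ with $A_j\in M_{n,m_j}(\mathbb{R})$, where each block $A_j$ is of the form $$\begin{pmatrix}e_{i_{j,1}}&\cdots&e_{i_{j,m_j}}\\0&\cdots&0\end{pmatrix}$$ except exactly one of them, $A_{j_0}$, of the form (with $j=j_0$) $$\begin{pmatrix}\sum_{s=1}^k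 e_{i_s}&e_{i_{j,2}}&\cdots&e_{i_{j,m_j}}\\1&0&\cdots&0\end{pmatrix}$$ for some $k\in\{0,\dots,l-1\}$, such that all basis vectors $e_{i_{j,j'}}$ involved are distinct and there is an increasing sequence $j_0<j_1<\cdots<j_k$ such that $e_{i_s}$ appears among the columns of the block $A_{j_s}$ (i.e. $i_s=i_{j_s,j'}$ for some $j'$) for all $s\in\{1,\dots,k\}$. Every $B'$-orbit on $G/P_{\underline m}$ contains a normal form. *)

(* Defs.v *)
From HB Require Import structures.
From mathcomp Require Import all_boot all_order all_algebra.
From mathcomp Require Import all_classical all_reals all_analysis.

Set Implicit Arguments.
Unset Strict Implicit.
Unset Printing Implicit Defensive.

Import Order.TTheory GRing.Theory Num.Theory.
Import numFieldNormedType.Exports.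

Local Open Scope classical_set_scope.
Local Open Scope ring_scope.
Local Open Scope quotient_scope.

Definition is_composition (n : nat) (m : seq nat) : Prop :=
  all (leq 1) m /\ sumn m = n.

Section GeneralLinearGroup.
Variables (R : realType) (n : nat).

Definition GL : Type := set_type [set A : 'M[R]_n | A \in unitmx].

(* The topology is the one induced by the inclusion in 'M[R]_n. *)
HB.instance Definition _ := Topological.copy GL
  (set_type [set A : 'M[R]_n | A \in unitmx]).

Definition GLmx (A : GL) : 'M[R]_n := set_val A.

Lemma GLmxP (A : GL) : GLmx A \in unitmx.
Proof. exact: (set_mem (proj2_sig A)). Qed.

Lemma GLmx_inj : injective GLmx.
Proof. exact: val_inj. Qed.

Definition toGL (A : 'M[R]_n) (uA : A \in unitmx) : GL := exist _ A (mem_set uA).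

Lemma GLmul_subproof (A B : GL) : GLmx A *m GLmx B \in unitmx.
Proof. by rewrite unitmx_mul !GLmxP. Qed.

Lemma GLinv_subproof (A : GL) : invmx (GLmx A) \in unitmx.
Proof. by rewrite unitmx_inv GLmxP. Qed.

Definition GLmul (A B : GL) : GL := toGL (GLmul_subproof A B).
Definition GLone : GL := toGL (unitmx1 R n).
Definition GLinv (A : GL) : GL := toGL (GLinv_subproof A).

Lemma GLmulA : associative GLmul.
Proof. by move=> A B C; apply: GLmx_inj; exact: mulmxA. Qed.
Lemma GLmul1 : left_id GLone GLmul.
Proof. by move=> A; apply: GLmx_inj; exact: mul1mx. Qed.
Lemma GLmulr1 : right_id GLone GLmul.
Proof. by move=> A; apply: GLmx_inj; exact: mulmx1. Qed.
Lemma GLmulV : left_inverse GLone GLinv GLmul.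
Proof. by move=> A; apply: GLmx_inj; apply: mulVmx; exact: GLmxP. Qed.
Lemma GLmulrV : right_inverse GLone GLinv GLmul.
Proof. by move=> A; apply: GLmx_inj; apply: mulmxV; exact: GLmxP. Qed.

HB.instance Definition _ :=
  isGroup.Build GL GLmulA GLmul1 GLmulr1 GLmulV GLmulrV.

Lemma GLmxM (A B : GL) : GLmx (A * B)%g = GLmx A *m GLmx B.
Proof. by []. Qed.
Lemma GLmx1 : GLmx 1%g = 1%:M.
Proof. by []. Qed.
Lemma GLmxV (A : GL) : GLmx (A^-1)%g = invmx (GLmx A).
Proof. by []. Qed.

End GeneralLinearGroup.

Coercion GLmx : GL >-> matrix.

Section Parabolic.
Variables (R : realType) (n : nat) (m : seq nat).
Local Notation G := (GL R n).

(* [reshape_index m i] is the (0-based) number of the block containing the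
   index i when 0, ..., n - 1 is cut into consecutive blocks of sizes m. *)
Definition parabolic : {pred G} :=
  [pred p : G | [forall i : 'I_n, forall j : 'I_n,
    (reshape_index m j < reshape_index m i)%N ==> (p i j == 0)]].

Lemma parabolicP (p : G) :
  reflect (forall i j : 'I_n,
             (reshape_index m j < reshape_index m i)%N -> p i j = 0)
          (p \in parabolic).
Proof.
apply: (iffP idP) => [/forallP h i j ij|h].
  by apply/eqP; exact: (implyP (forallP (h i) j)).
by apply/forallP => i; apply/forallP => j; apply/implyP => ij; apply/eqP/h.
Qed.

Lemma parabolic1 : (1%g : G) \in parabolic.
Proof.
apply/parabolicP => i j ij; rewrite GLmx1 mxE.
by case: eqP => // ijE; move: ij; rewrite ijE ltnn.
Qed.

Lemma parabolicM (p q : G) :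
  p \in parabolic -> q \in parabolic -> (p * q)%g \in parabolic.
Proof.
move=> /parabolicP hp /parabolicP hq; apply/parabolicP => i j ij.
rewrite GLmxM mxE big1// => k _.
have [ki|ik] := ltnP (reshape_index m k) (reshape_index m i).
  by rewrite hp ?mul0r.
by rewrite hq ?mulr0// (leq_trans ij).
Qed.

Lemma parabolicV (p : G) : p \in parabolic -> (p^-1)%g \in parabolic.
Proof.
move=> /parabolicP hp; apply/parabolicP => i j ij; rewrite GLmxV.
pose E : 'M[R]_n :=
  \matrix_(a, b) ((a == b) && (reshape_index m a <= reshape_index m j)%N)%:R.
have EE (X : 'M[R]_n) (a b : 'I_n) : (reshape_index m b <= reshape_index m j)%N ->
    (X *m E) a b = X a b.
  move=> bj; rewrite mxE (bigD1 b)//= big1 => [|c cb]; rewrite mxE.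
    by rewrite eqxx bj mulr1 addr0.
  by rewrite (negPf cb) mulr0.
have pE : p *m E = E *m (p *m E).
  apply/matrixP => a b; rewrite [RHS]mxE (bigD1 a)//= big1 => [|c ca].
    rewrite addr0 [E a a]mxE eqxx/=.
    have [|ja] := leqP (reshape_index m a); first by rewrite mul1r.
    rewrite mul0r mxE big1// => c _; rewrite [E c b]mxE.
    have [cj|_] := leqP (reshape_index m c) (reshape_index m j).
      by rewrite hp ?mul0r// (leq_ltn_trans cj).
    by rewrite andbF mulr0.
  by rewrite [E a c]mxE eq_sym (negPf ca) mul0r.
have sub : ((p *m E)^T <= E^T)%MS.
  by rewrite pE trmx_mul; exact: submxMl.
have rk : \rank (p *m E)^T = \rank E^T.
  by rewrite trmx_mul mxrankMfree// row_free_unit unitmx_tr GLmxP.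
have /submxP[D ED] : (E^T <= (p *m E)^T)%MS.
  by rewrite -(geq_leqif (mxrank_leqif_sup sub)) rk.
have {}ED : E = p *m E *m D^T by apply: trmx_inj; rewrite [RHS]trmx_mul trmxK.
rewrite -EE// {1}ED -mulmxA mulKmx ?GLmxP// mxE big1// => k _.
by rewrite mxE leqNgt ij andbF mul0r.
Qed.

Definition parabolic_rel : rel G := fun g h => (g^-1 * h)%g \in parabolic.

Lemma parabolic_rel_refl : reflexive parabolic_rel.
Proof. by move=> g; rewrite /parabolic_rel mulVg parabolic1. Qed.
Lemma parabolic_rel_sym : symmetric parabolic_rel.
Proof.
by move=> g h; apply/idP/idP => /parabolicV; rewrite /parabolic_rel invgM invgK.
Qed.
Lemma parabolic_rel_trans : transitive parabolic_rel.
Proof.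
move=> h g k gh hk; rewrite /parabolic_rel.
by rewrite -(mulVKg h k) mulgA parabolicM.
Qed.

Canonical parabolic_equiv :=
  EquivRel parabolic_rel parabolic_rel_refl parabolic_rel_sym
    parabolic_rel_trans.

(* G/P with the quotient topology; its points are the left cosets gP. *)
Definition GmodP : Type := quotient_topology {eq_quot parabolic_equiv}.
HB.instance Definition _ := Topological.copy GmodP
  (quotient_topology {eq_quot parabolic_equiv}).
HB.instance Definition _ := Quotient.copy GmodP
  (quotient_topology {eq_quot parabolic_equiv}).

Definition lcoset_of (g : G) : GmodP := \pi_GmodP g.

Lemma lcoset_ofP (g h : G) :
  reflect (lcoset_of g = lcoset_of h) ((g^-1 * h)%g \in parabolic).
Proof. exact: (eqmodP parabolic_equiv). Qed.

End Parabolic.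

Section Orbits.
Variables (R : realType) (n : nat) (m : seq nat).
Local Notation G := (GL R n).
Local Notation X := (GmodP R n m).

Definition GmodP_act (g : G) (x : X) : X :=
  lcoset_of m (g * (repr x : G))%g.

Lemma GmodP_actE (g h : G) :
  GmodP_act g (lcoset_of m h) = lcoset_of m (g * h)%g.
Proof.
apply/lcoset_ofP; rewrite invgM -mulgA mulKg; apply/lcoset_ofP.
exact: (reprK (lcoset_of m h)).
Qed.

Definition in_GLxGL1 (b : G) : Prop :=
  forall i j : 'I_n, (i < n.-1)%N != (j < n.-1)%N -> b i j = 0.

Definition upper_triangular (b : G) : Prop :=
  forall i j : 'I_n, (j < i)%N -> b i j = 0.

Definition borel' : set G := [set b | in_GLxGL1 b /\ upper_triangular b].

Definition borel'_orbit (x : X) : set X := [set GmodP_act b x | b in borel'].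

Definition borel'_fixed : set X :=
  [set x | forall b, borel' b -> GmodP_act b x = x].

End Orbits.

Section NormalForms.
Variables (R : realType) (n : nat) (m : seq nat).

(* For i < n - 1, the vector (e_{i+1}, 0); for i = n - 1, (0, 1). *)
Definition evec (i : nat) : 'cV[R]_n := \col_r ((r : nat) == i)%:R.

(* The j'-th column of the j-th block, both counted from 0, is one of the basis
   vectors, that is, it is not the first column of the distinguished block. *)
Definition basis_column (j0 j j' : nat) : Prop :=
  [/\ (j < size m)%N, (j' < nth 0%N m j)%N & (j, j') != (j0, 0%N)].

(* All indices count from 0. The distinguished block is j0, the vector in column
   j' of block j is the basis vector with index idx j j' (meaningful when
   basis_column j0 j j' holds), js is j_1, ..., j_k and is_ is i_1, ..., i_k, so
   that k = size js. *)
Record is_normal_form (A : 'M[R]_n) (j0 : nat) (idx : nat -> nat -> nat)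
    (js is_ : seq nat) : Prop := IsNormalForm {
  nf_block : (j0 < size m)%N;
  nf_idx_lt : forall j j', basis_column j0 j j' -> (idx j j' < n.-1)%N;
  nf_idx_inj : forall j1 j1' j2 j2',
    basis_column j0 j1 j1' -> basis_column j0 j2 j2' ->
    idx j1 j1' = idx j2 j2' -> (j1, j1') = (j2, j2');
  nf_k : (size js <= (size m).-1)%N;
  nf_size : size is_ = size js;
  nf_increasing : path ltn j0 js;
  nf_js_lt : all (gtn (size m)) js;
  nf_appears : forall s, (s < size js)%N ->
    exists2 j', basis_column j0 (nth 0%N js s) j' &
      nth 0%N is_ s = idx (nth 0%N js s) j';
  nf_basis_column : forall c : 'I_n,
    basis_column j0 (reshape_index m c) (reshape_offset m c) ->
    col c A = evec (idx (reshape_index m c) (reshape_offset m c));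
  nf_special_column : forall c : 'I_n,
    (reshape_index m c, reshape_offset m c) = (j0, 0%N) ->
    col c A = \sum_(i <- is_) evec i + evec n.-1
}.

Definition idx_increasing (j0 : nat) (idx : nat -> nat -> nat) : Prop :=
  forall j1 j1' j2 j2',
    basis_column j0 j1 j1' -> basis_column j0 j2 j2' ->
    (j1 < j2)%N -> (idx j1 j1' < idx j2 j2')%N.

Definition closed_normal_forms : set (GmodP R n m) :=
  [set x | exists (A : GL R n) j0 idx js is_,
    [/\ x = lcoset_of m A, is_normal_form A j0 idx js is_,
        size js = 0%N & idx_increasing j0 idx]].

End NormalForms.

(* Main.v *)
(* A closed orbit is closed under limits of curves in B'x.  Contracting by a
   one-parameter group of diagonal matrices brings any coset gP to a coset wP of
   a permutation matrix, and letting the parameter of a root subgroup tend to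
   infinity exchanges two basis vectors e_i, e_j (i < j < n) lying in blocks in
   the wrong order.  Hence a closed orbit contains wP with e_1, ..., e_(n-1)
   ordered along the blocks.  Such a point is B'-fixed, so it is the whole
   orbit, and it is a normal form with k = 0 once e_n is moved to the first
   column of its block. *)
Require Import Defs.
From mathcomp Require Import all_boot all_order perm all_algebra.
From mathcomp Require Import all_classical all_reals all_analysis.
From mathcomp Require Import zify ring.

Set Implicit Arguments.
Unset Strict Implicit.
Unset Printing Implicit Defensive.

Import Order.TTheory GRing.Theory Num.Theory.
Import numFieldNormedType.Exports.

Local Open Scope classical_set_scope.
Local Open Scope ring_scope.

(** * Products with matrix units *)

Lemma delta_mxM (R : nzRingType) (m n p : nat) (a : 'I_m) (b : 'I_n)
    (A : 'M[R]_(n, p)) x y :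
  (delta_mx a b *m A) x y = (x == a)%:R * A b y.
Proof.
rewrite mxE (bigD1 b)//= big1 => [|c cb]; rewrite mxE ?eqxx ?andbT ?addr0//.
by rewrite (negPf cb) andbF mul0r.
Qed.

Lemma mxM_delta (R : nzRingType) (m n p : nat) (A : 'M[R]_(m, n)) (a : 'I_n)
    (b : 'I_p) x y :
  (A *m delta_mx a b) x y = A x a * (y == b)%:R.
Proof.
rewrite mxE (bigD1 a)//= big1 => [|c cb]; rewrite mxE ?eqxx ?addr0//.
by rewrite (negPf cb) mulr0.
Qed.

(** * Limits of curves and closed points in the quotient *)

Section Topology.
Variables (R : realType) (n : nat) (m : seq nat).
Local Notation G := (GL R n).
Local Notation X := (GmodP R n m).

(** [GL] has the initial topology of its inclusion in matrices, and a matrix neighbourhood imposes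
    finitely many conditions, one for each entry, which hold near [t] simultaneously. *)
Lemma continuous_GL (T : topologicalType) (f : T -> G) :
  (forall i j, continuous (fun t => f t i j)) -> continuous f.
Proof.
move=> cf; apply: (@continuous_comp_initial _ _ _ set_val f).
move=> t A [P /= tP sPA].
have nP : forall ij : 'I_n * 'I_n, \forall s \near t, P ij.1 ij.2 (f s ij.1 ij.2).
  by move=> ij; exact: (cf _ _ _ _ (tP ij.1 ij.2)).
have {nP} : \forall s \near t, forall ij : 'I_n * 'I_n, P ij.1 ij.2 (f s ij.1 ij.2).
  exact: filter_forall nP.
by apply: filterS => s Ps; apply: sPA => i j; exact: (Ps (i, j)).
Qed.

Lemma GL_coord_continuous (i j : 'I_n) : continuous (fun g : G => g i j).
Proof.
move=> g; apply: (@continuous_comp G 'M[R]_n R (@GLmx R n) (fun M => M i j)).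
  exact: initial_continuous.
exact: coord_continuous.
Qed.

Lemma lcoset_of_continuous : continuous (@lcoset_of R n m).
Proof. exact: pi_continuous. Qed.

(** The form in which closedness is exploited: the curve converges to its value at 0 along the
    punctured neighbourhoods of 0, where [O] is known to contain it. *)
Lemma closed_limit (O : set X) (f : R -> G) :
  closed O -> (forall i j, continuous (fun s => f s i j)) ->
  (forall s, s != 0 -> O (lcoset_of m (f s))) -> O (lcoset_of m (f 0)).
Proof.
move=> cO cf Of.
have cg : continuous (lcoset_of m \o f).
  move=> s; apply: continuous_comp; first exact: continuous_GL.
  exact: lcoset_of_continuous.
have cvg0 : (lcoset_of m \o f) @ (0 : R)^' --> lcoset_of m (f 0).
  apply: cvg_trans (cg 0); apply: cvg_app; exact: nbhs_dnbhs.
apply: (@closed_cvg _ _ ((0 : R)^') _ (lcoset_of m \o f) O cO _ _ cvg0).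
exists 1 => [|s _ s0] /=; first exact: ltr01.
exact: Of.
Qed.

(** By definition of the quotient topology it suffices that gP is closed in G, and gP is cut out by
    the vanishing of entries of [g^-1 * h], which are continuous in [h]. *)
Lemma closed_lcoset (g : G) : closed [set lcoset_of m g].
Proof.
have coord i j : continuous (fun h : G => GLmx (g^-1 * h)%g i j).
  have -> : (fun h : G => GLmx (g^-1 * h)%g i j) =
      (fun h : G => \sum_k invmx g i k * h k j).
    by apply/funext => h; rewrite GLmxM mxE.
  apply: continuous_big => [|k _]; first exact: add_continuous.
  move=> h; apply: continuousM; first exact: cst_continuous.
  exact: GL_coord_continuous.
suff : closed (lcoset_of m @^-1` [set lcoset_of m g]) by rewrite -!openC.
have -> : lcoset_of m @^-1` [set lcoset_of m g] =
  \bigcap_(ij in [set ij : 'I_n * 'I_n |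
      (reshape_index m ij.2 < reshape_index m ij.1)%N])
    ((fun h : G => GLmx (g^-1 * h)%g ij.1 ij.2) @^-1` [set 0]).
  apply/seteqP; split => [h /= /esym /lcoset_ofP /parabolicP hP [i j] /=|h hP].
    exact: hP.
  by apply/esym/lcoset_ofP/parabolicP => i j ij; exact: (hP (i, j)).
apply: closed_bigI => -[i j] _ /=.
by move/continuous_closedP: (coord i j); apply; exact: closed_eq.
Qed.

End Topology.

(** * The action of [borel'] on cosets *)

Section Orbits.
Variables (R : realType) (n : nat) (m : seq nat).
Local Notation G := (GL R n).
Local Notation X := (GmodP R n m).

(** Here [q] is a plain matrix, so that it can be given by its entries; the equation identifies it
    with [g^-1 * h]. *)
Lemma lcoset_of_eq (g h : G) (q : 'M[R]_n) :
  (forall i j : 'I_n, (reshape_index m j < reshape_index m i)%N -> q i j = 0) ->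
  GLmx h = GLmx g *m q -> lcoset_of m h = lcoset_of m g.
Proof.
move=> qP hE; apply/esym/lcoset_ofP/parabolicP => i j ij.
by rewrite GLmxM GLmxV hE mulKmx ?GLmxP// qP.
Qed.

Lemma lcoset_of_surj (x : X) : exists g : G, x = lcoset_of m g.
Proof. by exists (repr x); rewrite /lcoset_of reprK. Qed.

Lemma GmodP_actM (a b : G) (x : X) :
  GmodP_act a (GmodP_act b x) = GmodP_act (a * b)%g x.
Proof. by case: (lcoset_of_surj x) => g ->; rewrite !GmodP_actE mulgA. Qed.

Lemma GmodP_act1 (x : X) : GmodP_act 1%g x = x.
Proof. by case: (lcoset_of_surj x) => g ->; rewrite GmodP_actE mul1g. Qed.

Lemma GmodP_act_inj (b : G) : injective (@GmodP_act R n m b).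
Proof.
by move=> x y xy; rewrite -(GmodP_act1 x) -(mulVg b) -GmodP_actM xy GmodP_actM
  mulVg GmodP_act1.
Qed.

Lemma borel'1 : @borel' R n 1%g.
Proof.
split=> i j ij; rewrite GLmx1 mxE; case: eqP => // ijE; move: ij; rewrite ijE.
  by rewrite eqxx.
by rewrite ltnn.
Qed.

Lemma borel'M (a b : G) : borel' a -> borel' b -> borel' (a * b)%g.
Proof.
move=> [a1 a2] [b1 b2]; split=> i j ij; rewrite GLmxM mxE big1// => k _.
  have [ik|ik] := boolP ((i < n.-1)%N == (k < n.-1)%N).
    by rewrite b1 ?mulr0// -(eqP ik).
  by rewrite a1 ?mul0r.
have [ki|ik] := ltnP k i; first by rewrite a2 ?mul0r.
by rewrite b2 ?mulr0// (leq_trans ij).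
Qed.

(** This is shared by orbits and by singletons of fixed points, the two kinds of sets to which the
    limit arguments are applied. *)
Definition borel'_stable (O : set X) : Prop :=
  forall b x, borel' b -> O x -> O (GmodP_act b x).

Lemma borel'_orbit_stable (x : X) : borel'_stable (borel'_orbit x).
Proof.
by move=> b _ Bb [a Ba <-]; exists (b * a)%g; rewrite ?GmodP_actM//; exact: borel'M.
Qed.

Lemma borel'_orbit_fixed (x : X) : borel'_fixed x -> borel'_orbit x = [set x].
Proof.
move=> fx; apply/seteqP; split=> [_ [b Bb <-]|_ ->] /=; first exact: fx.
by exists 1%g; [exact: borel'1|exact: GmodP_act1].
Qed.

Lemma borel'_orbit_refl (x : X) : borel'_orbit x x.
Proof. by exists 1%g; [exact: borel'1|exact: GmodP_act1]. Qed.

(* If bx is fixed then b(bx) = bx, and b acts injectively. *)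
Lemma fixed_in_borel'_orbit (x y : X) :
  borel'_orbit x y -> borel'_fixed y -> borel'_fixed x.
Proof. by move=> [b Bb <-] fy; rewrite -(GmodP_act_inj (fy b Bb)). Qed.

(** * Permutation matrices, transvections and reordering *)

Lemma permGL_subproof (s : 'S_n) : @perm_mx R n s^-1 \in unitmx.
Proof. exact: unitmx_perm. Qed.

(** The inverse makes column [c] the basis vector of index [s c]; in [perm_mx s] the rows have this
    property. *)
Definition permGL (s : 'S_n) : G := toGL (permGL_subproof s).

Lemma permGLE (s : 'S_n) i c : permGL s i c = (i == s c)%:R.
Proof. by rewrite /GLmx/= !mxE -(inj_eq (@perm_inj _ s)) permKV. Qed.

Lemma permGLM (s : 'S_n) (A : 'M[R]_n) i c :
  (GLmx (permGL s) *m A) i c = A ((s^-1)%g i) c.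
Proof.
by rewrite /GLmx/= -row_permE mxE.
Qed.

Lemma transvection_subproof (i j : 'I_n) (t : R) : i != j ->
  1%:M + t *: delta_mx i j \in unitmx.
Proof.
move=> ij; apply: (@mulmx1_unit _ _ _ (1%:M - t *: delta_mx i j) _).1.
rewrite mulmxDl mul1mx mulmxBr mulmx1 -scalemxAl -scalemxAr mul_delta_mx_0 1?eq_sym//.
by rewrite !scaler0 subr0 subrK.
Qed.

Definition transvection (i j : 'I_n) (t : R) (ij : i != j) : G :=
  toGL (transvection_subproof t ij).

Lemma transvection_borel' (i j : 'I_n) (t : R) (ij : i != j) :
  (i < j)%N -> (j < n.-1)%N -> borel' (transvection t ij).
Proof.
move=> lij jn; have iN := ltn_trans lij jn.
split=> x y xy; rewrite /GLmx/= !mxE.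
  have [xyE|_] := eqVneq x y; first by move: xy; rewrite xyE eqxx.
  rewrite add0r; case: eqP => [xi|]; case: eqP => [yj|]; rewrite ?mulr0//.
  by move: xy; rewrite xi yj iN jn.
have [xyE|_] := eqVneq x y; first by move: xy; rewrite xyE ltnn.
rewrite add0r; case: eqP => [xi|]; case: eqP => [yj|]; rewrite ?mulr0//.
by move: xy; rewrite xi yj => /(ltn_trans lij); rewrite ltnn.
Qed.

(* The matrix of the limiting curve sends e_c to e_(s c') + a e_(s c) and e_c'
   to e_(s c).  For a != 0 it is the translate of permGL s by the transvection
   of parameter a^-1, up to the parabolic matrix q. *)
Lemma closed_stable_swap (O : set X) (s : 'S_n) (c c' : 'I_n) :
  closed O -> borel'_stable O ->
  (reshape_index m c < reshape_index m c')%N ->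
  (s c' < s c)%N -> (s c < n.-1)%N ->
  O (lcoset_of m (permGL s)) ->
  O (lcoset_of m (permGL (tperm c c' * s)%g)).
Proof.
move=> cO sO cc' sc'c scn Os.
have nc'c : c' != c by apply: contraTneq cc' => ->; rewrite ltnn.
have nsc'c : s c' != s c by rewrite (inj_eq perm_inj).
pose f (a : R) : G := (permGL (tperm c c' * s)%g * transvection a nc'c)%g.
have fE a x y : f a x y = (x == s (tperm c c' y))%:R + a * ((x == s c) && (y == c))%:R.
  rewrite GLmxM mulmxDr mulmx1 -scalemxAr mxE permGLE permM; congr (_ + _).
  by rewrite mxE mxM_delta permGLE permM tpermR -natrM mulnb.
have -> : permGL (tperm c c' * s)%g = f 0.
  by apply: GLmx_inj; apply/matrixP => x y; rewrite fE permGLE permM mul0r addr0.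
apply: closed_limit => // [x y|a a0].
  rewrite (_ : (fun _ => _) = (fun a => (x == s (tperm c c' y))%:R
      + a * ((x == s c) && (y == c))%:R)); last by apply/funext => a; exact: fE.
  move=> a; apply: cvgD; first exact: cvg_cst.
  by apply: cvgMr_tmp; exact: cvg_id.
have Bu : borel' (transvection a^-1 nsc'c) by exact: transvection_borel'.
(* In the coordinates [c], [c'] this is the upper triangular matrix with diagonal a, -a^-1 and upper
   entry 1; elsewhere it is the identity. It is parabolic because the block of [c] precedes that of
   [c']. *)
pose q : 'M[R]_n := \matrix_(x, y) ((x == tperm c c' y)%:R
  + a * ((x == c) && (y == c))%:R - a^-1 * ((x == c') && (y == c'))%:R
  - ((x == c') && (y == c))%:R).
rewrite (_ : lcoset_of m (f a) =
    GmodP_act (transvection a^-1 nsc'c) (lcoset_of m (permGL s))).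
  exact: sO.
rewrite GmodP_actE; apply: (lcoset_of_eq (q := q)).
  move=> x y xy; rewrite mxE.
  have nxy : x != y by apply: contraTneq xy => ->; rewrite ltnn.
  case: tpermP nxy xy => [->|->|/eqP yc /eqP yc'] nxy xy.
  - rewrite (negPf nxy) eqxx (eq_sym c) (negPf nc'c) !andbT !andbF.
    by case: (x == c'); rewrite /= !mulr0 ?addr0 ?subr0 ?add0r ?subrr ?oppr0.
  - have /negPf xc : x != c.
      by apply: contraTneq xy => ->; rewrite -leqNgt ltnW.
    by rewrite xc (negPf nxy) (negPf nc'c) !andbF !mulr0 !addr0 !subr0.
  - by rewrite (negPf nxy) (negPf yc) (negPf yc') !andbF !mulr0 !addr0 !subr0.
apply/matrixP => x y; rewrite fE GLmxM -mulmxA mulmxDl mul1mx -scalemxAl mxE.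
rewrite [X in _ = _ + X]mxE delta_mxM !permGLM permK.
rewrite -[x in LHS](permKV s) !(inj_eq perm_inj) -[x in RHS](permKV s).
rewrite !(inj_eq perm_inj) permK.
move: (s^-1 x)%g => {}x; rewrite !mxE.
case: tpermP => [->|->|/eqP yc /eqP yc']; rewrite ?eqxx ?(negPf nc'c)
  ?(eq_sym c c') ?(negPf nc'c) ?(eq_sym c y) ?(negPf yc) ?(negPf yc') ?andbF ?andbT /=.
- have [->|_] := eqVneq x c; first by rewrite eq_sym (negPf nc'c) /=; field.
  by case: (eqVneq x c') => _; rewrite /=; field.
- have [->|_] := eqVneq x c; first by rewrite eq_sym (negPf nc'c) /=; field.
  by case: (eqVneq x c') => _; rewrite /=; field.
- by rewrite !(mulr0, subr0, addr0).
Qed.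

(** The column of the last basis vector, index [n.-1], is left free: elements of [borel'] do not mix
    that vector with the others. *)
Definition block_increasing (s : 'S_n) : Prop := forall c c' : 'I_n,
  (s c < n.-1)%N -> (s c' < n.-1)%N ->
  (reshape_index m c < reshape_index m c')%N -> (s c < s c')%N.

(* Swapping two entries in the wrong order increases the sum of s c times the
   block of c, so a maximizer has none. *)
Lemma closed_stable_block_increasing (O : set X) (s0 : 'S_n) :
  closed O -> borel'_stable O -> O (lcoset_of m (permGL s0)) ->
  exists2 s, block_increasing s & O (lcoset_of m (permGL s)).
Proof.
move=> cO sO Os0.
pose F (s : 'S_n) := (\sum_(c < n) s c * reshape_index m c)%N.
pose P := [pred s : 'S_n | `[< O (lcoset_of m (permGL s)) >]].
have Ps0 : P s0 by exact/asboolP.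
have [s /asboolP Os smax] := arg_maxnP F Ps0.
exists s => // c c' scn sc'n cc'; rewrite ltnNge; apply/negP => sc'c.
have nc'c : c' != c by apply: contraTneq cc' => ->; rewrite ltnn.
have {}sc'c : (s c' < s c)%N.
  by rewrite ltn_neqAle sc'c andbT (inj_eq val_inj) (inj_eq perm_inj).
have /asboolP /smax := closed_stable_swap cO sO cc' sc'c scn Os.
have FE u : F u = (u c * reshape_index m c + (u c' * reshape_index m c' +
    \sum_(d < n | (d != c) && (d != c')) u d * reshape_index m d))%N.
  by rewrite /F (bigD1 c)//= (bigD1 c').
have rest : (\sum_(d < n | (d != c) && (d != c'))
      (tperm c c' * s)%g d * reshape_index m d =
    \sum_(d < n | (d != c) && (d != c')) s d * reshape_index m d)%N.
  by apply: eq_bigr => d /andP[dc dc']; rewrite permM tpermD 1?eq_sym.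
rewrite !FE rest !permM tpermL tpermR.
(* With r the block number, the swap adds (s c - s c')(r c' - r c) > 0 to [F]. *)
by move: (\sum_(d < n | _) _)%N => r; nia.
Qed.

(** Conjugating [b] by the permutation matrix gives the entries [b (s i) (s j)]. Below the block
    diagonal they vanish by triangularity if both indices are less than [n.-1], and by [in_GLxGL1]
    if exactly one is; both cannot equal [n.-1]. *)
Lemma block_increasing_fixed (s : 'S_n) :
  block_increasing s -> borel'_fixed (lcoset_of m (permGL s)).
Proof.
move=> si b [b1 b2]; rewrite GmodP_actE.
apply: (lcoset_of_eq (q := \matrix_(i, j) b (s i) (s j))).
  move=> i j ji; rewrite mxE.
  have [sin|sin] := ltnP (s i) n.-1; have [sjn|sjn] := ltnP (s j) n.-1.
  - exact: b2 (si _ _ sjn sin ji).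
  - by rewrite b1// sin ltnNge sjn.
  - by rewrite b1// sjn ltnNge sin.
  have /perm_inj ijE : s i = s j.
    by apply: val_inj => /=; have := ltn_ord (s i); have := ltn_ord (s j); lia.
  by move: ji; rewrite ijE ltnn.
apply/matrixP => i j; rewrite permGLM GLmxM !mxE permKV.
rewrite (bigD1 (s j))//= big1 ?addr0 => [|k kj]; rewrite permGLE ?eqxx ?mulr1//.
by rewrite (negPf kj) mulr0.
Qed.

(** * Normal forms with k = 0 as ordered permutation matrices *)

Lemma evecE i r : @evec R n i r 0 = ((r : nat) == i)%:R.
Proof. by rewrite mxE. Qed.

Hypothesis mn : is_composition n m.

Lemma reshape_index_lt (c : 'I_n) : (reshape_index m c < size m)%N.
Proof. by apply: reshape_indexP; rewrite mn.2. Qed.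

Lemma reshape_offset_lt (c : 'I_n) :
  (reshape_offset m c < nth 0 m (reshape_index m c))%N.
Proof. by apply: reshape_offsetP; rewrite mn.2. Qed.

Lemma reshape_ord_inj (c c' : 'I_n) :
  (reshape_index m c, reshape_offset m c) =
    (reshape_index m c', reshape_offset m c') -> c = c'.
Proof.
by move=> [ri ro]; apply: val_inj; rewrite /= -(reshape_indexK m c) ri ro
  reshape_indexK.
Qed.

Lemma basis_columnP (j0 : nat) (c : 'I_n) :
  (reshape_index m c, reshape_offset m c) != (j0, 0%N) ->
  basis_column m j0 (reshape_index m c) (reshape_offset m c).
Proof. by split; [exact: reshape_index_lt|exact: reshape_offset_lt|]. Qed.

(** For k = 0 the special column is the last basis vector. The others are distinct with indices less
    than [n.-1], so the column indices form a permutation, and (ii) says that it is ordered along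
    the blocks. *)
Lemma closed_normal_form_perm (x : X) : closed_normal_forms x ->
  exists2 s, block_increasing s & x = lcoset_of m (permGL s).
Proof.
move=> [A [j0 [idx [js [is_ [-> [jm ilt iinj _ szi _ _ _ bc sc] /eqP js0 inc]]]]]].
have {}sc (c : 'I_n) :
    (reshape_index m c, reshape_offset m c) = (j0, 0%N) ->
    col c A = evec R n n.-1.
  have /nilP is0 : nilp is_ by rewrite /nilp szi.
  by move=> /sc ->; rewrite is0 big_nil add0r.
pose special (c : 'I_n) := (reshape_index m c, reshape_offset m c) == (j0, 0%N).
pose sg (c : 'I_n) := if special c then n.-1
  else idx (reshape_index m c) (reshape_offset m c).
have sgn c : (sg c < n)%N.
  have n0 : (0 < n)%N by exact: leq_ltn_trans (ltn_ord c).
  rewrite /sg; case: ifPn => [_|/basis_columnP /ilt]; first by rewrite prednK.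
  by move/leq_trans; apply; exact: leq_pred.
have sg_inj : injective (fun c => Ordinal (sgn c)).
  move=> c c' [] /=; rewrite /sg; case: ifPn => [/eqP cj|/basis_columnP cb];
      case: ifPn => [/eqP cj'|/basis_columnP cb'].
  - by move=> _; apply: reshape_ord_inj; rewrite cj.
  - by have := ilt _ _ cb' => + nE; rewrite -nE ltnn.
  - by have := ilt _ _ cb => + nE; rewrite nE ltnn.
  - by move/(iinj _ _ _ _ cb cb'); exact: reshape_ord_inj.
exists (perm sg_inj).
  move=> c c'; rewrite !permE /= /sg.
  case: ifPn => [_|/basis_columnP cb]; first by rewrite ltnn.
  case: ifPn => [_|/basis_columnP cb']; first by rewrite ltnn.
  by move=> _ _; exact: inc.
congr lcoset_of; apply: GLmx_inj; apply/matrixP => i c.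
rewrite permGLE permE -[i == _]/(_ == _ :> nat) /=.
transitivity (col c A i 0); first by rewrite mxE.
rewrite /sg; case: ifPn => [/eqP /sc ->|/basis_columnP /bc ->]; exact: evecE.
Qed.

Hypothesis n_gt0 : (0 < n)%N.

(** A normal form has its last basis vector in the first column [c1] of a block. Exchanging [c1]
    with the column [c0] of that vector in the same block is right multiplication by a parabolic
    matrix, so the coset is unchanged. *)
Lemma block_increasing_closed_normal_form (s : 'S_n) :
  block_increasing s -> closed_normal_forms (lcoset_of m (permGL s)).
Proof.
have Nn : (n.-1 < n)%N by rewrite prednK.
pose N := Ordinal Nn; pose c0 := (s^-1 N)%g; pose j0 := reshape_index m c0.
have j0m : (j0 < size m)%N by exact: reshape_index_lt.
have mj0 : (0 < nth 0 m j0)%N by exact: (all_nthP 0%N mn.1).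
have c1n : (flatten_index m j0 0 < n)%N.
  by rewrite -[X in (_ < X)%N]mn.2 flatten_indexP.
pose c1 := Ordinal c1n.
have c1j : reshape_index m c1 = j0 by rewrite flatten_indexKl.
have c1o : reshape_offset m c1 = 0%N by rewrite flatten_indexKr.
move=> si; pose t := (tperm c1 c0 * s)%g.
have tc1 : t c1 = N by rewrite permM tpermL permKV.
have btp c : reshape_index m (tperm c1 c0 c) = reshape_index m c.
  by case: tpermP => [->|->|//]; rewrite c1j.
have ti : block_increasing t.
  by move=> c c'; rewrite !permM => sc sc' cc'; apply: si; rewrite ?btp.
have -> : lcoset_of m (permGL s) = lcoset_of m (permGL t).
  apply/esym/(lcoset_of_eq (q := perm_mx (tperm c1 c0))).
    move=> i j ij; rewrite !mxE; case: eqP => // ijE.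
    by move: ij; rewrite -ijE btp ltnn.
  apply/matrixP => i j; rewrite permGLM permGLE !mxE permM.
  rewrite -[i in LHS](permKV s) (inj_eq perm_inj).
  by rewrite -[X in _ = (_ == X)%:R](tpermK c1 c0) (inj_eq perm_inj).
(* Every [basis_column] has flat index less than [n], so the default [c1] is taken only outside the
   range of the normal form. *)
pose idx j j' : nat := t (insubd c1 (flatten_index m j j')).
have idxE j j' (jj' : basis_column m j0 j j') : exists c : 'I_n,
    [/\ reshape_index m c = j, reshape_offset m c = j' & idx j j' = t c].
  have [jm j'm _] := jj'.
  have pn : (flatten_index m j j' < n)%N.
    by rewrite -[X in (_ < X)%N]mn.2 flatten_indexP.
  exists (Ordinal pn); split; [exact: flatten_indexKl|exact: flatten_indexKr|].
  by rewrite /idx; congr (val (t _)); apply: val_inj; rewrite val_insubd pn.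
have idx_lt j j' : basis_column m j0 j j' -> (idx j j' < n.-1)%N.
  move=> jj'; have [c [ci co ->]] := idxE _ _ jj'.
  have : t c != N.
    rewrite -tc1 (inj_eq perm_inj); apply: contraTneq isT => cc1.
    by have [_ _ /eqP[]] := jj'; rewrite -ci -co cc1 c1j c1o.
  by rewrite -(inj_eq val_inj) /=; have := ltn_ord (t c); lia.
exists (permGL t), j0, idx, [::], [::]; split => //; last first.
  move=> j1 j1' j2 j2' b1 b2 j12.
  have := idx_lt _ _ b1; have := idx_lt _ _ b2.
  have [c [ci _ ->]] := idxE _ _ b1; have [c' [ci' _ ->]] := idxE _ _ b2.
  by move=> tc' tc; apply: ti => //; rewrite ci ci'.
split => //.
- move=> j1 j1' j2 j2' b1 b2.
  have [c [<- <- ->]] := idxE _ _ b1; have [c' [<- <- ->]] := idxE _ _ b2.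
  by move=> /val_inj /perm_inj ->.
- move=> c b; apply/matrixP => i k; rewrite ord1 evecE mxE permGLE.
  by have [d [dc do_ ->]] := idxE _ _ b; rewrite (@reshape_ord_inj d c) ?dc ?do_.
- move=> c cj; apply/matrixP => i k; rewrite big_nil add0r ord1 evecE mxE permGLE.
  by rewrite (@reshape_ord_inj c c1) ?tc1// cj c1j c1o.
Qed.

End Orbits.

(* If P A = L U with P the matrix of s, then A is s L U, and conjugating the
   unipotent lower triangular L by a contracting one-parameter group of diagonal
   matrices deforms it into the identity, while U is absorbed in the parabolic. *)
Lemma closed_stable_perm (R : realType) (n : nat) (m : seq nat)
    (O : set (GmodP R n.+1 m)) (x : GmodP R n.+1 m) :
  closed O -> borel'_stable O -> O x ->
  exists s : 'S_n.+1, O (lcoset_of m (permGL R s)).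
Proof.
move=> cO sO; have [A ->] := lcoset_of_surj x => OA.
have := cormen_lup_correct (GLmx A); have := cormen_lup_perm (GLmx A).
have := cormen_lup_lower (GLmx A); have := cormen_lup_upper (GLmx A).
case: (cormen_lup _) => -[P L U] /= Uu Ll /is_perm_mxP[s ->] PA.
exists s.
(* For t != 0 this is the conjugate of [L] by the diagonal matrix of entries t^r. Its exponents are
   nonnegative, so it extends to t = 0, where it is the identity. *)
pose Lt (t : R) : 'M[R]_n.+1 :=
  \matrix_(i, j) if (i <= j)%N then (i == j)%:R else L i j * t ^+ (i - j).
have Ltu t : Lt t \in unitmx.
  rewrite unitmxE det_trig; last first.
    apply/is_trig_mxP => i j ij.
    by rewrite mxE ltnW// -(inj_eq val_inj) /= ltn_eqF.
  by rewrite big1 ?unitr1// => i _; rewrite mxE leqnn eqxx.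
pose f t : GL R n.+1 := (permGL R s * toGL (Ltu t))%g.
have fE t i j : f t i j = Lt t ((s^-1)%g i) j by rewrite GLmxM permGLM.
have -> : permGL R s = f 0.
  apply: GLmx_inj; apply/matrixP => i j.
  rewrite fE permGLE mxE -[i in LHS](permKV s) (inj_eq perm_inj).
  case: leqP => // ji; rewrite expr0n subn_eq0 leqNgt ji mulr0.
  by rewrite -(inj_eq val_inj) /= gtn_eqF.
apply: closed_limit => // [i j|t t0].
  rewrite (_ : (fun _ => _) = fun t => Lt t ((s^-1)%g i) j); last first.
    by apply/funext => t; exact: fE.
  rewrite /Lt; under eq_fun do rewrite mxE.
  case: leqP => _ t; first exact: cvg_cst.
  by apply: cvgMl_tmp; exact: exprn_continuous.
(* The exponents are permuted so that moving [D] to the right past [permGL R s] turns it into the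
   diagonal matrix of entries t^r. *)
pose D : 'M[R]_n.+1 := diag_mx (\row_r t ^+ ((s^-1)%g r)).
have Du : D \in unitmx.
  rewrite unitmxE det_diag unitfE; apply/prodf_neq0 => i _.
  by rewrite mxE expf_neq0.
have BD : borel' (toGL Du).
  split=> i j ij; rewrite /GLmx/= !mxE; case: eqP => // ijE; move: ij;
    by rewrite ijE ?eqxx ?ltnn.
suff -> : lcoset_of m (f t) = GmodP_act (toGL Du) (lcoset_of m A) by exact: sO.
rewrite GmodP_actE; apply/esym.
apply: (lcoset_of_eq (q := diag_mx (\row_r t ^+ r) *m U)).
  move=> i j ij; rewrite mul_diag_mx mxE Uu ?mulr0//.
  (* Block numbers are nondecreasing in the index, so upper triangular matrices are parabolic. *)
  by rewrite ltnNge (reshape_leq m) negb_or -leqNgt ltnW//= gtn_eqF.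
have AE : GLmx A = permGL R s *m (L *m U).
  rewrite (_ : GLmx (permGL R s) = invmx (perm_mx s)); last exact: perm_mxV.
  by rewrite -[L *m U]PA mulKmx ?unitmx_perm.
rewrite GLmxM AE !mulmxA; congr (_ *m U); rewrite -mulmxA.
apply/matrixP => i j.
rewrite mul_diag_mx mxE permGLM mul_mx_diag [RHS]mxE fE !mxE.
case: leqP => [ij|ji]; last by rewrite -mulrA -exprD subnK 1?mulrC// ltnW.
by rewrite Ll//; case: eqP => [->|_]; rewrite ?mulr1 ?mul1r ?mulr0 ?mul0r.
Qed.

(** * Closed orbits, fixed points and normal forms *)

Theorem corollaryC (R : realType) (n : nat) (m : seq nat) :
  (2 <= n)%N -> is_composition n m ->
  [set O : set (GmodP R n m) | (exists x, O = borel'_orbit x) /\ closed O] =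
    [set [set x] | x in @borel'_fixed R n m] /\
  [set O : set (GmodP R n m) | (exists x, O = borel'_orbit x) /\ closed O] =
    [set borel'_orbit x | x in @closed_normal_forms R n m].
Proof.
move=> n2 mn.
have closed_stable_ordered (O : set (GmodP R n m)) x : closed O -> borel'_stable O -> O x ->
    exists2 s, block_increasing m s & O (lcoset_of m (permGL R s)).
  case: n n2 mn O x => // n' _ _ O x cO sO Ox.
  have [s Os] := closed_stable_perm cO sO Ox.
  exact: closed_stable_block_increasing Os.
have closed_orbits :
    [set O : set (GmodP R n m) | (exists x, O = borel'_orbit x) /\ closed O] =
    [set [set x] | x in @borel'_fixed R n m].
  apply/seteqP; split=> [_ [[x ->] cx]|_ [x fx <-]] /=.
    have [s si xs] := closed_stable_ordered _ x cx (@borel'_orbit_stable _ _ _ x)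
      (borel'_orbit_refl x).
    have fx := fixed_in_borel'_orbit xs (block_increasing_fixed si).
    by exists x => //; rewrite borel'_orbit_fixed.
  split; first by exists x; rewrite borel'_orbit_fixed.
  by have [g ->] := lcoset_of_surj x; exact: closed_lcoset.
split=> //; rewrite closed_orbits.
have -> : @closed_normal_forms R n m = @borel'_fixed R n m.
  apply/seteqP; split=> [x /(closed_normal_form_perm mn) [s si ->]|x fx].
    exact: block_increasing_fixed.
  (* A fixed point is by itself a closed stable set, so the ordered permutation coset found in that
     set is the point itself. *)
  have cx : closed [set x] by have [g ->] := lcoset_of_surj x; exact: closed_lcoset.
  have sx : borel'_stable [set x] by move=> b _ Bb ->; exact: fx.
  have [s si <-] := closed_stable_ordered _ x cx sx erefl.
  by apply: block_increasing_closed_normal_form => //; exact: ltnW.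
by apply/seteqP; split=> _ [x fx <-]; exists x => //; rewrite borel'_orbit_fixed.
Qed.
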